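(* Let $a,b,n$ be positive integers with $a>b$, and define \[ T_1(an,bn,q)'=\sum_{k=an-bn-\lfloor n/2\rfloor}^{an-bn}(-q)^k\begin{bmatrix} an\\ k\end{bmatrix}_{q^2}\begin{bmatrix} 2an-2k\\ an-bn-k\end{bmatrix}. \] Then \[ T_1(an,bn,q)'\equiv(-q)^{an-bn}\begin{bmatrix} an\\ bn\end{bmatrix}_{q^2}\Big\{1-2(a-b)\big(1-\vartheta_n(q)\big)\Big\}\pmod{\Phi_n(q)^2}, \] where \[ \vartheta_n(q)=\begin{cases} (-1)^m(1+q^{2m})q^{m(3m-5)/2}, &\text{if } n=3m,\\ (-1)^mq^{m(3m+1)/2}, &\text{if } n=3m+1,\\ (-1)^{m+1}q^{(m-1)(3m+2)/2}, &\text{if } n=3m+2.\end{cases} \]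
   Context: For integers $n,m$, the $q$-binomial coefficient is $\begin{bmatrix} n\\ m\end{bmatrix}_q=\begin{bmatrix} n\\ m\end{bmatrix}=\frac{(1-q^n)(1-q^{n-1})\cdots(1-q^{n-m+1})}{(1-q)(1-q^2)\cdots(1-q^m)}$ if $0\le m\le n$, and $0$ otherwise; $\begin{bmatrix} n\\ m\end{bmatrix}_{q^2}$ is the same with $q$ replaced by $q^2$. $\Phi_n(q)$ denotes the $n$-th cyclotomic polynomial. $\lfloor x\rfloor$ is the integer part of $x$. For rational functions (including Laurent polynomials) $A(q),B(q)$, $A\equiv B\pmod{\Phi_n(q)^2}$ means $A-B=\Phi_n(q)^2P(q)/Q(q)$ with $P,Q\in\mathbb{Z}[q]$ and $Q$ coprime to $\Phi_n(q)$. *)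

(* Defs.v *)
From mathcomp Require Import all_boot all_order all_algebra all_field.

Set Implicit Arguments.
Unset Strict Implicit.
Unset Printing Implicit Defensive.

Import GRing.Theory.
Local Open Scope ring_scope.

Definition qvar : {fraction {poly int}} := tofrac 'X.

(* Division in a field is total; for x = qvar or x = qvar ^+ 2 no factor of the
   denominator vanishes. *)
Definition qbinom (K : fieldType) (x : K) (n m : int) : K :=
  if (0 <= m) && (m <= n) then
    (\prod_(0 <= i < `|m|%N) (1 - x ^ (n - i%:Z)))
      / (\prod_(0 <= i < `|m|%N) (1 - x ^+ i.+1))
  else 0.

(* Coprimality in {poly int} is coprimality over the rationals; as 'Phi_n is
   monic, this agrees with having no common nonunit factor in Z[q].  It also
   forces Q != 0. *)
Definition eqmod_Phi2 (n : nat) (A B : {fraction {poly int}}) : Prop :=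
  exists P Q : {poly int},
    coprimep Q 'Phi_n /\ A - B = tofrac ('Phi_n ^+ 2 * P) / tofrac Q.

(* For 0 < n and b < a, the subtractions in the range of summation
   are not truncated. *)
Definition T1' (a b n : nat) : {fraction {poly int}} :=
  \sum_((a * n - b * n - n %/ 2)%N <= k < (a * n - b * n).+1)
    (- qvar) ^+ k
      * qbinom (qvar ^+ 2) (a * n)%N k
      * qbinom qvar ((2 * (a * n))%N%:Z - (2 * k)%N%:Z)
                    ((a * n)%N%:Z - (b * n)%N%:Z - k%:Z).

(* The exponents are integers (some are negative: -1 for n = 2, 3), and each
   division by 2 is exact. *)
Definition vartheta (n : nat) : {fraction {poly int}} :=
  let m : int := (n %/ 3)%N in
  match (n %% 3)%N with
  | 0%N => (-1) ^ m * (1 + qvar ^ (2 * m))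
             * qvar ^ ((m * (3 * m - 5)) %/ 2)%Z
  | 1%N => (-1) ^ m * qvar ^ ((m * (3 * m + 1)) %/ 2)%Z
  | _ => (-1) ^ (m + 1) * qvar ^ (((m - 1) * (3 * m + 2)) %/ 2)%Z
  end.

(* Main.v *)
Require Import Defs.
From mathcomp Require Import all_boot all_order all_algebra all_field.
From mathcomp Require Import zify ring.

(** Put s = (a - b) n and t = b n, and reindex by k = s - j with j <= n/2. The
    j = 0 term is M = (-q)^s [an; bn]_{q^2}; every other term is M times
    (1 - q^{2s}) U_j with U_j integral at Phi_n, so U_j only matters modulo
    Phi_n. There q^n = 1 gives U_j = - W_j, where
      (1 - q^n) W_j = (-1)^{j-1} q^{j(j-3)/2} (1 - q^n) / (1 - q^{n-j}) [n-j; j].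
    As 1 - q^{2s} = 2(a - b)(1 - q^n) modulo Phi_n^2, the claim reduces to the
    exact identity (1 - q^n) sum_j W_j = 1 - vartheta_n. The left side is
    1 - A_n + q^{-1} A_{n-2} with A_n = sum_j (-1)^j q^{j(j-1)/2} [n-j; j], and the
    two Pascal rules yield A_{n+3} = - q^{n+1} A_n, hence A_n in closed form. *)

Import GRing.Theory.
Local Open Scope ring_scope.

(** * Gaussian binomials over a field in which no positive power of x is 1 *)

Section GaussianBinomials.
Variables (K : fieldType) (x : K).
Hypothesis x_not_root1 : forall i, 1 - x ^+ i.+1 != 0.

Definition qfac (n : nat) : K := \prod_(i < n) (1 - x ^+ i.+1).

(** No case distinction is needed: for n < m the factor at i = n is 1 - x^0 = 0. *)
Definition qbin (n m : nat) : K := (\prod_(i < m) (1 - x ^+ (n - i))) / qfac m.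

Lemma qfacS n : qfac n.+1 = qfac n * (1 - x ^+ n.+1).
Proof. by rewrite /qfac big_ord_recr. Qed.

Lemma qfac_neq0 n : qfac n != 0.
Proof. by apply/prodf_neq0 => i _. Qed.

Lemma qbin0 n : qbin n 0 = 1.
Proof. by rewrite /qbin /qfac !big_ord0 divr1. Qed.

Lemma qbin_small n m : (n < m)%N -> qbin n m = 0.
Proof.
move=> lt_nm; rewrite /qbin (bigD1 (Ordinal lt_nm)) //= subnn expr0 subrr.
by rewrite !mul0r.
Qed.

Lemma qbinSr n m : qbin n m.+1 = qbin n m * ((1 - x ^+ (n - m)) / (1 - x ^+ m.+1)).
Proof. by rewrite /qbin qfacS big_ord_recr /= mulf_div. Qed.

Lemma qbinSS n m : qbin n.+1 m.+1 = qbin n m * ((1 - x ^+ n.+1) / (1 - x ^+ m.+1)).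
Proof. by rewrite /qbin qfacS big_ord_recl /= mulf_div [X in X / _]mulrC. Qed.

Lemma qbin_pascal n m : qbin n.+1 m.+1 = x ^+ m.+1 * qbin n m.+1 + qbin n m.
Proof.
have [lt_nm | le_mn] := ltnP n m; first by rewrite !qbin_small ?mulr0 ?addr0 // ltnW.
rewrite qbinSS qbinSr; move: (x_not_root1 m).
have -> : x ^+ n.+1 = x ^+ (n - m) * x ^+ m.+1 by rewrite -exprD addnS subnK.
by move=> ?; field.
Qed.

Lemma qbin_pascal' n m : (m <= n)%N ->
  qbin n.+1 m.+1 = qbin n m.+1 + x ^+ (n - m) * qbin n m.
Proof.
move=> le_mn; rewrite qbinSS qbinSr; move: (x_not_root1 m).
have -> : x ^+ n.+1 = x ^+ (n - m) * x ^+ m.+1 by rewrite -exprD addnS subnK.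
by move=> ?; field.
Qed.

Lemma prod_qfac n m : (m <= n)%N ->
  qfac n = qfac (n - m) * \prod_(i < m) (1 - x ^+ (n - i)).
Proof.
elim: m => [|m IHm] lt_mn; first by rewrite subn0 big_ord0 mulr1.
rewrite (IHm (ltnW lt_mn)) big_ord_recr /= -{1}(subnSK lt_mn) qfacS subnSK //.
ring.
Qed.

Lemma qbin_qfac n m : (m <= n)%N -> qbin n m = qfac n / (qfac m * qfac (n - m)).
Proof.
move=> le_mn; rewrite /qbin (prod_qfac _ _ le_mn).
by field; rewrite !qfac_neq0.
Qed.

(** Write both sides with q-factorials; passing from (s, t) to (s - j, t + j) removes the top j
    factors of [qfac s] and adds j factors to [qfac t]. *)
Lemma qbin_shift s t j : (j <= s)%N ->
  qbin (s + t) (s - j) =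
  qbin (s + t) t * \prod_(i < j) ((1 - x ^+ (s - i)) / (1 - x ^+ (t + i.+1))).
Proof.
move=> le_js; rewrite !qbin_qfac ?leq_addl //; last by lia.
rewrite addnK (_ : s + t - (s - j) = t + j)%N; last by lia.
rewrite (prod_qfac _ _ le_js).
have -> : qfac (t + j) = qfac t * \prod_(i < j) (1 - x ^+ (t + i.+1)).
  rewrite /qfac big_split_ord /=; congr (_ * _).
  by apply: eq_bigr => i _; rewrite addnS.
rewrite prodf_div.
have : \prod_(i < j) (1 - x ^+ (s - i)) != 0.
  apply/prodf_neq0 => i _; rewrite -(prednK (_ : 0 < s - i)%N) ?subn_gt0 //.
  exact: leq_trans le_js.
have : \prod_(i < j) (1 - x ^+ (t + i.+1)) != 0.
  by apply/prodf_neq0 => i _; rewrite addnS.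
move: (qfac_neq0 t) (qfac_neq0 (s - j)).
move: (\prod_(i < j) _) (\prod_(i < j) _) (qfac _) (qfac _) => p r u v.
by move=> *; field; apply/and4P.
Qed.

Lemma qbinomE (n m : nat) : qbinom x n m = qbin n m.
Proof.
rewrite /qbinom lez_nat /=; case: leqP => [le_mn|/qbin_small->//].
rewrite /qbin /qfac !big_mkord; congr (_ / _).
by apply: eq_bigr => i _; rewrite subzn // (leq_trans (ltnW (ltn_ord i))).
Qed.

(** * The alternating sums A_n: recurrence and closed form *)

Definition qfib n : K := \sum_(j < n.+1) (-1) ^+ j * x ^+ 'C(j, 2) * qbin (n - j) j.
(* The companion of [qfib] that closes up the recurrences given by the two Pascal
   rules. *)
Definition qfib' n : K := \sum_(j < n.+1) (-1) ^+ j * x ^+ 'C(j.+1, 2) * qbin (n - j) j.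

(** The first Pascal rule contributes x^(j+1), which raises the weight C(j+1, 2) to C(j+2, 2), the
    one in [qfib']. *)
Lemma qfibSS n : qfib n.+2 = qfib' n.+1 - qfib' n.
Proof.
rewrite /qfib big_ord_recr /= (qbin_small (n.+2 - n.+2)) ?subnn // mulr0 addr0.
rewrite /qfib' big_ord_recl [in RHS]big_ord_recl -addrA -sumrB; congr (_ + _).
  by rewrite !qbin0.
apply: eq_bigr => i _; rewrite !lift0 !subSS subSn; last by rewrite -ltnS.
by rewrite qbin_pascal [in RHS]binS bin1 exprD exprS; ring.
Qed.

(** The second Pascal rule contributes x^(n-2i), and C(i+2, 2) + n - 2i = C(i, 2) + n + 1, so the
    power x^(n+1) comes out of the sum. *)
Lemma qfib'SS n : qfib' n.+2 = qfib' n.+1 - x ^+ n.+1 * qfib n.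
Proof.
rewrite /qfib' big_ord_recr /= (qbin_small (n.+2 - n.+2)) ?subnn // mulr0 addr0.
rewrite big_ord_recl [in RHS]big_ord_recl /qfib mulr_sumr -addrA -sumrB.
congr (_ + _); first by rewrite !qbin0.
apply: eq_bigr => i _; rewrite !lift0 !subSS subSn; last by rewrite -ltnS.
have [lt_ni | le_in] := ltnP (n - i) i;
  first by rewrite !qbin_small ?ltnS ?mulr0 ?subr0 // ltnW.
rewrite qbin_pascal' // !binS !bin1 bin0 exprS.
have -> : x ^+ n.+1 = x ^+ (n - i - i) * x ^+ i * x ^+ i * x.
  by rewrite -!exprD -exprSr; congr (x ^+ _); lia.
by rewrite !exprD expr1; ring.
Qed.

Lemma qfibSSS n : qfib n.+3 = - x ^+ n.+1 * qfib n.
Proof. by rewrite qfibSS qfib'SS; ring. Qed.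

Lemma qfib_3m m : qfib (3 * m) = (-1) ^+ m * x ^+ (3 * 'C(m, 2) + m).
Proof.
elim: m => [|m IHm].
  by rewrite /qfib big_ord_recl big_ord0 qbin0 /=; ring.
rewrite mulnS qfibSSS IHm binS bin1 mulNr mulrCA -exprD exprS mulN1r mulNr.
by do 3!congr (_ _); lia.
Qed.

Lemma qfib_3m1 m : qfib (3 * m).+1 = (-1) ^+ m * x ^+ (3 * 'C(m, 2) + 2 * m).
Proof.
elim: m => [|m IHm].
  rewrite /qfib !big_ord_recl big_ord0 qbin0 /= (qbin_small _ 1) //.
  by rewrite bin_small //; ring.
rewrite mulnS qfibSSS IHm binS bin1 mulNr mulrCA -exprD exprS mulN1r mulNr.
by do 3!congr (_ _); lia.
Qed.

Lemma qfib_3m2 m : qfib (3 * m).+2 = 0.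
Proof.
elim: m => [|m IHm]; last by rewrite mulnS qfibSSS IHm mulr0.
rewrite qfibSS /qfib' !big_ord_recl !big_ord0 !qbin0 /= (qbin_small _ 1) //.
by rewrite (@bin_small 1 2) // mulr0; ring.
Qed.

(** * The sum of the W_j and its match with vartheta_n *)

Hypothesis x_neq0 : x != 0.

(* [qlucas_term n j] is W_{j+1}. *)
Definition qlucas_term n j : K :=
  (-1) ^+ j / x ^+ j.+1 *
  ((\prod_(i < j) (x ^+ (j - i) * (1 - x ^+ (n - j - 2 - i)))) / qfac j.+1).

Lemma prod_expr_sub j : \prod_(i < j) x ^+ (j - i) = x ^+ 'C(j.+1, 2).
Proof.
elim: j => [|j IHj]; first by rewrite big_ord0 bin_small.
rewrite big_ord_recl /= subn0 binS bin1 addnC exprD -IHj; congr (_ * _).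
Qed.

(** Split 1 - x^(n+2) = x^(j+1) (1 - x^(n-j+1)) + (1 - x^(j+1)): the first part turns [n-j; j] into
    [n+1-j; j+1], the second cancels the last factor of [qfac j.+1]. *)
Lemma qlucas_termE n j : (j <= n)%N ->
  (1 - x ^+ n.+2) * qlucas_term n.+2 j =
  - ((-1) ^+ j.+1 * x ^+ 'C(j.+1, 2) * qbin (n.+1 - j) j.+1)
  + x^-1 * ((-1) ^+ j * x ^+ 'C(j, 2) * qbin (n - j) j).
Proof.
move=> le_jn; rewrite /qlucas_term big_split /= prod_expr_sub.
have -> : (n.+2 - j - 2 = n - j)%N by lia.
rewrite subSn // qbinSS.
have -> : x ^+ n.+2 = x ^+ (n - j) * x * x ^+ j.+1.
  by rewrite -exprSr -exprD; congr (x ^+ _); lia.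
rewrite /qbin qfacS [(-1) ^+ _.+1]exprS [x ^+ (n - j).+1]exprSr.
have : x ^+ 'C(j.+1, 2) = x ^+ 'C(j, 2) * x ^+ j.+1 / x.
  by rewrite binS bin1 exprD exprSr mulrA mulfK.
move=> ->; move: (x_not_root1 j) (qfac_neq0 j) (expf_neq0 j.+1 x_neq0) x_neq0.
move: (\prod_(i < j) _) (qfac j) (x ^+ 'C(j, 2)) (x ^+ (n - j)) (x ^+ j.+1).
by move=> p f c u v *; field; apply/and4P.
Qed.

Lemma sum_qlucas_term n :
  (1 - x ^+ n.+2) * (\sum_(j < n.+2 %/ 2) qlucas_term n.+2 j) =
  1 - (qfib n.+2 - x^-1 * qfib n).
Proof.
(* The added terms vanish: their factor at i = n - j is 1 - x^0. *)
have -> : \sum_(j < n.+2 %/ 2) qlucas_term n.+2 j = \sum_(j < n.+1) qlucas_term n.+2 j.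
  rewrite -!(big_mkord xpredT (qlucas_term n.+2)).
  rewrite [RHS](@big_cat_nat _ _ _ (n.+2 %/ 2)) //=; last by lia.
  rewrite [X in _ + X]big_nat_cond [X in _ + X]big1 ?addr0 //.
  move=> j /andP[/andP[le_j lt_j] _].
  have lt_nj : (n - j < j)%N by lia.
  rewrite /qlucas_term (bigD1 (Ordinal lt_nj)) //=.
  by rewrite (_ : n.+2 - j - 2 - (n - j) = 0)%N ?subrr ?mulr0 ?mul0r ?mulr0 //; lia.
rewrite mulr_sumr.
under eq_bigr => j _ do rewrite (qlucas_termE _ _ (ltnSE (ltn_ord j))).
rewrite big_split /= sumrN -mulr_sumr.
have -> : qfib n.+2 =
    1 + \sum_(i < n.+1) (-1) ^+ i.+1 * x ^+ 'C(i.+1, 2) * qbin (n.+1 - i) i.+1.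
  rewrite /qfib big_ord_recr /= (qbin_small (n.+2 - n.+2)) ?subnn // mulr0 addr0.
  by rewrite big_ord_recl qbin0 expr0 !mul1r.
by rewrite /qfib; ring.
Qed.

(* [vartheta] is convertible to the instance at [qvar]. *)
Definition qtheta n : K :=
  let m : int := (n %/ 3)%N in
  match (n %% 3)%N with
  | 0%N => (-1) ^ m * (1 + x ^ (2 * m)) * x ^ ((m * (3 * m - 5)) %/ 2)%Z
  | 1%N => (-1) ^ m * x ^ ((m * (3 * m + 1)) %/ 2)%Z
  | _ => (-1) ^ (m + 1) * x ^ (((m - 1) * (3 * m + 2)) %/ 2)%Z
  end.

(** As A_(3m+2) = 0, only one of the two terms survives unless 3 divides n + 2; then both do, which
    produces the factor 1 + q^(2m). *)
Lemma qthetaE n : qtheta n.+2 = qfib n.+2 - x^-1 * qfib n.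
Proof.
have halfz (u v : int) : u = v * 2 -> (u %/ 2)%Z = v by move=> ->; rewrite mulzK.
(* Turns the quadratic exponents into binomials, so that the halving is exact. *)
have bin2z (m : nat) : m%:Z * m%:Z = m%:Z + 2 * 'C(m, 2)%:Z.
  by elim: m => // m IHm; rewrite binS bin1; lia.
rewrite {1}/qtheta (divn_eq n 3) mulnC.
have : (n %% 3 < 3)%N by rewrite ltn_mod.
move: (n %/ 3)%N (n %% 3)%N => m [|[|[|//]]] _.
- rewrite addn0 -addn2.
  rewrite (_ : (3 * m + 2) %/ 3 = m)%N; last by lia.
  rewrite (_ : (3 * m + 2) %% 3 = 2)%N; last by lia.
  rewrite addn2 qfib_3m2 ?qfib_3m.
  rewrite (halfz _ ((3 * 'C(m, 2) + m)%N%:Z - 1)); last by have := bin2z m; lia.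
  rewrite [x ^ _]expfzDr // exprN1 (_ : m%:Z + 1 = m.+1) -?exprnP; last by lia.
  by rewrite exprS; ring.
- rewrite addn1 (_ : (3 * m).+3 = 3 * m.+1)%N; last by lia.
  rewrite mulKn // modnMr qfib_3m ?qfib_3m1.
  rewrite (halfz _ ((3 * 'C(m, 2) + 2 * m)%N%:Z - 1)); last by have := bin2z m; lia.
  rewrite [x ^ (_ - 1)]expfzDr // exprN1 (_ : 2 * m.+1%:Z = (2 * m).+2%N%:Z)
    -?exprnP; last by lia.
  rewrite (_ : 3 * 'C(m.+1, 2) + m.+1 = (3 * 'C(m, 2) + 2 * m) + (2 * m).+1)%N; last first.
    by rewrite binS bin1; lia.
  rewrite [x ^+ (_ + _.+1)]exprD [x ^+ _.+2]exprS [x ^+ (_.+1)]exprS [(-1) ^+ m.+1]exprS.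
  move: (x ^+ (2 * m)) (x ^+ _) ((-1) ^+ m) => u v w.
  by field.
- rewrite (_ : (3 * m + 2).+2 = (3 * m.+1).+1)%N; last by lia.
  rewrite (_ : (3 * m.+1).+1 %/ 3 = m.+1)%N; last by lia.
  rewrite (_ : (3 * m.+1).+1 %% 3 = 1)%N; last by lia.
  rewrite addn2 qfib_3m2 ?qfib_3m1.
  rewrite (halfz _ ((3 * 'C(m.+1, 2) + 2 * m.+1)%N%:Z)); last by have := bin2z m.+1; lia.
  by rewrite -!exprnP mulr0 subr0.
Qed.

(** * Ratio of the j-th summand to the j = 0 summand *)

Definition ratio_factor s t j i : K :=
  (1 - x ^+ (2 * (s - i.+1))) * (1 - x ^+ (2 * t + j + i.+2))
  / (1 - x ^+ (2 * (t + i.+1))).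

(* [ratio_term s t j] is U_{j+1}. *)
Definition ratio_term s t j : K :=
  (-1) ^+ j.+1 / x ^+ j.+1 * ((\prod_(i < j) ratio_factor s t j i) / qfac j.+1).

End GaussianBinomials.

Section Ratio.
Variables (K : fieldType) (x : K).
Hypothesis x_not_root1 : forall i, 1 - x ^+ i.+1 != 0.
Hypothesis x_neq0 : x != 0.

Lemma sqr_not_root1 i : 1 - (x ^+ 2) ^+ i.+1 != 0.
Proof. by rewrite -exprM mulnS; apply: x_not_root1. Qed.

(** In the quotient of the q^2-binomials, the first numerator 1 - x^(2s) is set apart and the last
    denominator 1 - x^(2t+2j+2) cancels the top factor of [2t+2j+2; j+1]. The j remaining factors
    are paired off. *)
Lemma qbin_ratio s t j : (j < s)%N ->
  (- x) ^+ (s - j.+1) * qbin _ (x ^+ 2) (s + t) (s - j.+1)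
    * qbin _ x (2 * t + 2 * j.+1) j.+1 =
  (- x) ^+ s * qbin _ (x ^+ 2) (s + t) t
    * ((1 - x ^+ (2 * s)) * ratio_term _ x s t j).
Proof.
move=> lt_js; rewrite qbin_shift //; last exact: sqr_not_root1.
have -> : (- x) ^+ s = (- x) ^+ (s - j.+1) * (x ^+ j.+1 / (-1) ^+ j.+1).
  by rewrite invr_sign [x ^+ _ * _]mulrC -exprNn -exprD subnK.
rewrite /ratio_term /ratio_factor !prodf_div big_split /=.
have -> : \prod_(i < j.+1) (1 - (x ^+ 2) ^+ (s - i)) =
    (1 - x ^+ (2 * s)) * \prod_(i < j) (1 - x ^+ (2 * (s - i.+1))).
  rewrite big_ord_recl subn0 -exprM; congr (_ * _).
  by apply: eq_bigr => i _; rewrite lift0 -exprM.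
have -> : \prod_(i < j.+1) (1 - (x ^+ 2) ^+ (t + i.+1)) =
    \prod_(i < j) (1 - x ^+ (2 * (t + i.+1))) * (1 - x ^+ (2 * t + 2 * j.+1)).
  rewrite big_ord_recr /= -exprM mulnDr; congr (_ * _).
  by apply: eq_bigr => i _; rewrite -exprM.
have -> : qbin _ x (2 * t + 2 * j.+1) j.+1 = (1 - x ^+ (2 * t + 2 * j.+1)) *
    (\prod_(i < j) (1 - x ^+ (2 * t + j + i.+2)) / qfac _ x j.+1).
  rewrite /qbin big_ord_recl subn0 -mulrA; congr (_ * (_ / _)).
  rewrite (reindex_inj rev_ord_inj); apply: eq_bigr => i _.
  by rewrite lift0 /=; congr (1 - x ^+ _); have := ltn_ord i; lia.
have : \prod_(i < j) (1 - x ^+ (2 * (t + i.+1))) != 0.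
  by apply/prodf_neq0 => i _; rewrite exprM addnS; apply: sqr_not_root1.
have : 1 - x ^+ (2 * t + 2 * j.+1) != 0 by rewrite mulnS addnCA; apply: x_not_root1.
move: (qfac_neq0 _ _ x_not_root1 j.+1) (expf_neq0 j.+1 x_neq0).
move: (\prod_(i < j) _) (\prod_(i < j) _) (\prod_(i < j) _) => p r v.
move: (qfac _ _ _) (x ^+ j.+1) (x ^+ _) (x ^+ _) (qbin _ _ _ _) => f c d e g.
by move=> *; field; rewrite signr_eq0; apply/and4P.
Qed.

(** Arranged so that, if n divides A + E and C + D + E, each of the three differences on the right
    vanishes modulo Phi_n. *)
Lemma ratio_factor_identity A C D E : 1 - x ^+ E != 0 ->
  (1 - x ^+ A) * (1 - x ^+ (C + E)) / (1 - x ^+ E) - x ^+ C * (1 - x ^+ D) =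
  ((1 - x ^+ (C + D + E)) - (x ^+ A - x ^+ (C + D))
   + (x ^+ (A + (C + E)) - x ^+ C)) * (1 - x ^+ E)^-1.
Proof. by rewrite !exprD => ?; field. Qed.

End Ratio.

(** * Localization of Z[q] at Phi_n *)

Section LocalRing.
Variable n : nat.
Hypothesis n_gt0 : (0 < n)%N.

(* [Phi_dvd k] is the k-th power of the maximal ideal of the localization of
   Z[q] at the prime ideal (Phi_n). *)
Definition Phi_dvd (k : nat) (A : {fraction {poly int}}) : Prop :=
  exists P Q : {poly int},
    coprimep Q 'Phi_n /\ A = tofrac ('Phi_n ^+ k * P) / tofrac Q.

Lemma coprime_Phi_neq0 (Q : {poly int}) : coprimep Q 'Phi_n -> tofrac Q != 0.
Proof.
rewrite tofrac_eq0; apply: contraTneq => ->.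
rewrite coprime0p -size_poly_eq1 size_Cyclotomic eqSS -lt0n totient_gt0.
by rewrite n_gt0.
Qed.

Lemma Phi_dvdD k A B : Phi_dvd k A -> Phi_dvd k B -> Phi_dvd k (A + B).
Proof.
move=> [P [Q [cQ ->]]] [R [S [cS ->]]]; exists (P * S + R * Q), (Q * S).
split; first by rewrite coprimepMl cQ.
rewrite addf_div ?coprime_Phi_neq0 // -!tofracM -tofracD.
by rewrite mulrDr !mulrA.
Qed.

Lemma Phi_dvdM j k A B : Phi_dvd j A -> Phi_dvd k B -> Phi_dvd (j + k) (A * B).
Proof.
move=> [P [Q [cQ ->]]] [R [S [cS ->]]]; exists (P * R), (Q * S).
split; first by rewrite coprimepMl cQ.
by rewrite mulf_div -!tofracM exprD mulrACA.
Qed.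

Lemma Phi_dvd_poly P : Phi_dvd 0 (tofrac P).
Proof. by exists P, 1; rewrite coprime1p expr0 mul1r tofrac1 divr1. Qed.

Lemma Phi_dvd_inv Q : coprimep Q 'Phi_n -> Phi_dvd 0 (tofrac Q)^-1.
Proof. by move=> cQ; exists 1, Q; rewrite expr0 mul1r tofrac1 div1r. Qed.

Lemma Phi_dvd1 : Phi_dvd 0 1.
Proof. by rewrite -tofrac1; apply: Phi_dvd_poly. Qed.

Lemma Phi_dvd0 k : Phi_dvd k 0.
Proof. by exists 0, 1; rewrite coprime1p mulr0 tofrac0 mul0r. Qed.

Lemma Phi_dvdN k A : Phi_dvd k A -> Phi_dvd k (- A).
Proof.
move=> dA; rewrite -mulN1r -[k]add0n -tofrac1 -tofracN.
exact: Phi_dvdM (Phi_dvd_poly _) dA.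
Qed.

Lemma Phi_dvdB k A B : Phi_dvd k A -> Phi_dvd k B -> Phi_dvd k (A - B).
Proof. by move=> dA dB; apply/Phi_dvdD/Phi_dvdN. Qed.

Lemma Phi_dvd_sum k m (F : 'I_m -> {fraction {poly int}}) :
  (forall i, Phi_dvd k (F i)) -> Phi_dvd k (\sum_i F i).
Proof. by move=> dF; apply: big_ind => //; [apply: Phi_dvd0 | apply: Phi_dvdD]. Qed.

Lemma Phi_dvd_prod m (F : 'I_m -> {fraction {poly int}}) :
  (forall i, Phi_dvd 0 (F i)) -> Phi_dvd 0 (\prod_i F i).
Proof. by move=> dF; apply: big_ind => //; [apply: Phi_dvd1 | apply: Phi_dvdM]. Qed.

Lemma Phi_dvd_prodB m (F G : 'I_m -> {fraction {poly int}}) :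
  (forall i, Phi_dvd 0 (F i)) -> (forall i, Phi_dvd 0 (G i)) ->
  (forall i, Phi_dvd 1 (F i - G i)) -> Phi_dvd 1 (\prod_i F i - \prod_i G i).
Proof.
move=> dF dG dFG.
(* Congruence is multiplicative only between integral elements, so integrality is carried through
   the induction. *)
pose good A B := [/\ Phi_dvd 1 (A - B), Phi_dvd 0 A & Phi_dvd 0 B].
suff [] : good (\prod_i F i) (\prod_i G i) by [].
apply: big_ind2 => [|A B A' B' [dAB dA dB] [dAB' dA' dB']|i _].
- by split; rewrite ?subrr; [apply: Phi_dvd0 | apply: Phi_dvd1 | apply: Phi_dvd1].
- split; [|exact: (Phi_dvdM 0 0)|exact: (Phi_dvdM 0 0)].
  have -> : A * A' - B * B' = (A - B) * A' + B * (A' - B') by ring.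
  by apply: Phi_dvdD; [apply: (Phi_dvdM 1 0) | apply: (Phi_dvdM 0 1)].
- by split.
Qed.

Local Notation pZtoC := (map_poly (intr : int -> algC)).

(* A nonconstant common divisor has a complex root, which is a primitive n-th
   root of unity because it is a root of Phi_n. *)
Lemma coprime_Phi (P : {poly int}) :
  (forall z : algC, n.-primitive_root z -> (pZtoC P).[z] != 0) ->
  coprimep P 'Phi_n.
Proof.
move=> nzP.
(* Divisibility over [int] is pseudo-divisibility: it holds up to a nonzero integer factor c,
   harmless for roots. *)
have dvd_root (d p : {poly int}) z : d %| p -> root (pZtoC d) z -> root (pZtoC p) z.
  case/Pdiv.Idomain.dvdpP=> -[c e] /= nz_c /(congr1 (fun r => (pZtoC r).[z])).
  rewrite map_polyZ rmorphM hornerZ hornerM => E /rootP dz0.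
  move/eqP: E; rewrite dz0 mulr0 mulf_eq0 intr_eq0 (negbTE nz_c) /=.
  by move/eqP/rootP.
apply/Pdiv.Idomain.coprimepP => d dP dPhi; rewrite -size_poly_eq1.
have inj_intr : injective (intr : int -> algC) by apply: intr_inj.
rewrite -(size_map_inj_poly inj_intr (rmorph0 _)).
apply: contraT => /closed_rootP[z dz].
have [w w_prim] := C_prim_root_exists n_gt0.
have := dvd_root _ _ _ dPhi dz; rewrite (Cintr_Cyclotomic w_prim).
rewrite root_cyclotomic // => z_prim; case/negP: (nzP _ z_prim).
exact: dvd_root dP dz.
Qed.

Lemma coprime_Phi_1Xn k : ~~ (n %| k)%N -> coprimep (1 - 'X^k) 'Phi_n.
Proof.
move=> ndvd; apply: coprime_Phi => z z_prim.
rewrite rmorphB rmorph1 /= map_polyXn !hornerE subr_eq0 eq_sym.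
by rewrite -(prim_order_dvd z_prim).
Qed.

Lemma coprime_Phi_Xn k : coprimep 'X^k 'Phi_n.
Proof.
apply: coprime_Phi => z z_prim; rewrite map_polyXn hornerXn expf_neq0 //.
apply/eqP => z0; have := prim_expr_order z_prim.
by rewrite z0 expr0n gtn_eqF // => /eqP; rewrite eq_sym oner_eq0.
Qed.

Lemma qvarXE k : qvar ^+ k = tofrac 'X^k.
Proof. by rewrite tofracXn. Qed.

Lemma Phi_dvd_qvarX k : Phi_dvd 0 (qvar ^+ k).
Proof. by rewrite qvarXE; apply: Phi_dvd_poly. Qed.

Lemma Phi_dvd_qvarV k : Phi_dvd 0 (qvar ^+ k)^-1.
Proof. by rewrite qvarXE; apply: Phi_dvd_inv (coprime_Phi_Xn k). Qed.

Lemma Phi_dvd_1qvarX k : Phi_dvd 0 (1 - qvar ^+ k).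
Proof. exact: Phi_dvdB Phi_dvd1 (Phi_dvd_qvarX k). Qed.

Lemma Phi_dvd_1qvarV k : ~~ (n %| k)%N -> Phi_dvd 0 (1 - qvar ^+ k)^-1.
Proof.
move=> ndvd; rewrite qvarXE -tofrac1 -tofracB.
exact: Phi_dvd_inv (coprime_Phi_1Xn _ ndvd).
Qed.

Lemma Phi_dvd_1Xn k : Phi_dvd 1 (1 - qvar ^+ (k * n)).
Proof.
have PhiXn : exists R : {poly int}, 'X^n - 1 = 'Phi_n * R.
  exists (\prod_(d <- divisors n | d != n) 'Phi_d).
  by rewrite -prod_Cyclotomic // (bigD1_seq n) ?divisors_id ?divisors_uniq.
case: PhiXn => R XnE.
exists (- R * \sum_(i < k) 'X^(n * i)), 1; rewrite coprime1p tofrac1 divr1; split=> //.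
rewrite qvarXE -tofrac1 -tofracB; congr tofrac.
rewrite mulrA mulrN -XnE opprB mulnC exprM.
under eq_bigr => i _ do rewrite exprM.
by rewrite -[LHS]opprB subrX1 -mulNr opprB.
Qed.

Lemma Phi_dvd_qvarXB j k : j = k %[mod n] -> Phi_dvd 1 (qvar ^+ j - qvar ^+ k).
Proof.
wlog le_jk : j k / (j <= k)%N => [hw eq_jk|].
  have [/hw|/ltnW/hw] := leqP j k; first exact.
  by move/(_ (esym eq_jk))/Phi_dvdN; rewrite opprB.
move=> /esym/eqP; rewrite eqn_mod_dvd // => /dvdnP[d kE].
rewrite -(subnK le_jk) kE exprD.
have -> : qvar ^+ j - qvar ^+ (d * n) * qvar ^+ j = (1 - qvar ^+ (d * n)) * qvar ^+ j.
  by rewrite mulrBl mul1r.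
exact: Phi_dvdM (Phi_dvd_1Xn d) (Phi_dvd_qvarX j).
Qed.

(* The denominator of [qbin] may vanish at Phi_n; integrality comes from the
   Pascal rule instead. *)
Lemma Phi_dvd_qbin (x : {fraction {poly int}}) m k :
  (forall i, 1 - x ^+ i.+1 != 0) -> Phi_dvd 0 x -> Phi_dvd 0 (qbin _ x m k).
Proof.
move=> nz_x dx; elim: m k => [|m IHm] [|k].
- by rewrite qbin0; apply: Phi_dvd1.
- by rewrite qbin_small //; apply: Phi_dvd0.
- by rewrite qbin0; apply: Phi_dvd1.
rewrite qbin_pascal //; apply: Phi_dvdD; last exact: IHm.
apply: (Phi_dvdM 0 0); last exact: IHm.
by elim: k.+1 => [|i IHi]; [apply: Phi_dvd1 | rewrite exprS; apply: (Phi_dvdM 0 0)].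
Qed.

(** In 1 - q^(kn) = (1 - q^n) sum_i q^(in), each q^(in) is 1 modulo Phi_n and the outer factor
    supplies the second power. *)
Lemma Phi_dvd2_1Xn k :
  Phi_dvd 2 (1 - qvar ^+ (k * n) - k%:R * (1 - qvar ^+ n)).
Proof.
have -> : 1 - qvar ^+ (k * n) - k%:R * (1 - qvar ^+ n) =
    (1 - qvar ^+ n) * \sum_(i < k) (qvar ^+ (i * n) - 1).
  rewrite sumrB sumr_const card_ord [RHS]mulrBr [k%:R * _]mulrC; congr (_ - _).
  rewrite mulnC exprM -[LHS]opprB subrX1 -mulNr opprB; congr (_ * _).
  by apply: eq_bigr => i _; rewrite mulnC exprM.
apply: (Phi_dvdM 1 1); first by rewrite -[n in qvar ^+ n]mul1n; apply: Phi_dvd_1Xn.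
by apply: Phi_dvd_sum => i; rewrite -opprB; apply/Phi_dvdN/Phi_dvd_1Xn.
Qed.

(** * Reduction of U_j modulo Phi_n *)

Lemma ndvdn_double_shift b i : (0 < i)%N -> (2 * i < n)%N -> ~~ (n %| 2 * (b * n + i))%N.
Proof.
move=> i_gt0 lt_in; rewrite mulnDr mulnA dvdn_addr; last exact: dvdn_mull.
by rewrite gtnNdvd // muln_gt0.
Qed.

(** The cutoff j <= n/2 of the sum enters here: 2(i+1) lies strictly between 0 and n. The borderline
    denominator with 2(i+1) = n was cancelled in [qbin_ratio]. *)
Lemma Phi_dvd_ratio_factor s b j i : (i < j)%N -> (2 * j.+1 <= n)%N ->
  Phi_dvd 0 (ratio_factor _ qvar s (b * n) j i).
Proof.
move=> lt_ij le_jn; apply: (Phi_dvdM 0 0).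
  by apply: (Phi_dvdM 0 0); apply: Phi_dvd_1qvarX.
by apply/Phi_dvd_1qvarV/ndvdn_double_shift => //; lia.
Qed.

(** With q^n = 1, (1 - q^(-2i-2)) / (1 - q^(2i+2)) = - q^(-2i-2), and multiplying by 1 - q^(j+i+2)
    gives q^(j-i) (1 - q^(-j-2-i)). *)
Lemma ratio_factor_eqmod c b j i : (i < j)%N -> (2 * j.+1 <= n)%N ->
  Phi_dvd 1 (ratio_factor _ qvar (c.+1 * n) (b * n) j i
             - qvar ^+ (j - i) * (1 - qvar ^+ (n - j - 2 - i))).
Proof.
move=> lt_ij le_jn; rewrite /ratio_factor.
have ndvd : ~~ (n %| 2 * (b * n + i.+1))%N by apply: ndvdn_double_shift => //; lia.
rewrite (_ : 2 * (b * n) + j + i.+2 = (j - i) + 2 * (b * n + i.+1))%N; last by lia.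
rewrite ratio_factor_identity; last first.
  rewrite qvarXE -tofrac1 -tofracB; apply: coprime_Phi_neq0.
  exact: coprime_Phi_1Xn.
apply: (Phi_dvdM 1 0); last exact: Phi_dvd_1qvarV.
apply: Phi_dvdD; first apply: Phi_dvdB.
- rewrite (_ : _ + _ = (2 * b).+1 * n)%N; [exact: Phi_dvd_1Xn | lia].
- apply: Phi_dvd_qvarXB.
  set e := (j - i + _)%N.
  by rewrite (_ : 2 * _ = (2 * c).+1 * n + e)%N ?modnMDl // /e; lia.
- apply: Phi_dvd_qvarXB.
  by rewrite (_ : _ + _ = (2 * (c.+1 + b)) * n + (j - i))%N ?modnMDl //; lia.
Qed.

Lemma Phi_dvd_qfacV j : (j < n)%N -> Phi_dvd 0 (qfac _ qvar j)^-1.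
Proof.
move=> lt_jn; rewrite -prodfV; apply: Phi_dvd_prod => i.
by apply: Phi_dvd_1qvarV; rewrite gtnNdvd // (leq_ltn_trans _ lt_jn).
Qed.

Lemma Phi_dvd_sign j : Phi_dvd 0 ((-1) ^+ j).
Proof. by rewrite -tofrac1 -tofracN -tofracXn; apply: Phi_dvd_poly. Qed.

Lemma Phi_dvd_qlucas_term j : (j.+1 < n)%N -> Phi_dvd 0 (qlucas_term _ qvar n j).
Proof.
move=> lt_jn; apply: (Phi_dvdM 0 0).
  by apply: (Phi_dvdM 0 0); [apply: Phi_dvd_sign | apply: Phi_dvd_qvarV].
apply: (Phi_dvdM 0 0); last exact: Phi_dvd_qfacV.
apply: Phi_dvd_prod => i.
by apply: (Phi_dvdM 0 0); [apply: Phi_dvd_qvarX | apply: Phi_dvd_1qvarX].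
Qed.

Lemma ratio_term_eqmod c b j : (2 * j.+1 <= n)%N ->
  Phi_dvd 1 (ratio_term _ qvar (c.+1 * n) (b * n) j + qlucas_term _ qvar n j).
Proof.
move=> le_jn; rewrite /ratio_term /qlucas_term exprS mulN1r !mulNr addrC -mulrBr -mulrBl.
rewrite -opprB mulNr mulrN; apply: Phi_dvdN.
apply: (Phi_dvdM 0 1).
  by apply: (Phi_dvdM 0 0); [apply: Phi_dvd_sign | apply: Phi_dvd_qvarV].
apply: (Phi_dvdM 1 0); last by apply: Phi_dvd_qfacV; lia.
apply: Phi_dvd_prodB => i.
- exact: Phi_dvd_ratio_factor.
- by apply: (Phi_dvdM 0 0); [apply: Phi_dvd_qvarX | apply: Phi_dvd_1qvarX].
- exact: ratio_factor_eqmod.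
Qed.

End LocalRing.

(** * Specialization to the variable q and the final congruence *)

Lemma qvar_neq0 : qvar != 0.
Proof. by rewrite tofrac_eq0 polyX_eq0. Qed.

Lemma qvar_not_root1 i : 1 - qvar ^+ i.+1 != 0.
Proof.
rewrite qvarXE -tofrac1 -tofracB tofrac_eq0 subr_eq0.
by apply/eqP => /(congr1 (fun p : {poly int} => size p)); rewrite size_polyXn size_poly1.
Qed.

Lemma qvar2_not_root1 i : 1 - (qvar ^+ 2) ^+ i.+1 != 0.
Proof. exact: sqr_not_root1 qvar_not_root1 i. Qed.

Lemma sum_qlucas_vartheta n : (0 < n)%N ->
  (1 - qvar ^+ n) * (\sum_(j < n %/ 2) qlucas_term _ qvar n j) = 1 - vartheta n.
Proof.
case: n => [//|[_|n _]].
  (* For n = 1, outside the range of the identity in n + 2, the sum is empty and vartheta_1 = 1. *)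
  by rewrite big_ord0 mulr0 /vartheta /= !mul0r; rewrite mulr1 subrr.
rewrite sum_qlucas_term ?[vartheta _]qthetaE //;
  by [exact: qvar_not_root1 | exact: qvar_neq0].
Qed.

Lemma T1'_qfactor a b n : (b < a)%N ->
  T1' a b n = (- qvar) ^+ (a * n - b * n) * qbin _ (qvar ^+ 2) (a * n) (b * n)
    * (1 + (1 - qvar ^+ (2 * (a * n - b * n)))
           * \sum_(j < n %/ 2) ratio_term _ qvar (a * n - b * n) (b * n) j).
Proof.
move=> lt_ba; rewrite /T1'; set s := (a * n - b * n)%N; set t := (b * n)%N.
have le_ns : (n <= s)%N by rewrite /s -mulnBl leq_pmull // subn_gt0.
have -> : (a * n = s + t)%N by rewrite subnK // leq_mul2r ltnW ?orbT.
have le_hn : (n %/ 2 <= n)%N by lia.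
rewrite -[X in \sum_(X <= _ < _) _]add0n big_addn.
rewrite (_ : s.+1 - (s - n %/ 2) = (n %/ 2).+1)%N; last by lia.
(* Reversing the order makes the summation index j = s - k. *)
rewrite big_mkord (reindex_inj rev_ord_inj) /=.
have termE (j : 'I_(n %/ 2).+1) :
    (- qvar) ^+ ((n %/ 2).+1 - j.+1 + (s - n %/ 2))
      * qbinom (qvar ^+ 2) (s + t)%N ((n %/ 2).+1 - j.+1 + (s - n %/ 2))%N
      * qbinom qvar ((2 * (s + t))%N%:Z - (2 * ((n %/ 2).+1 - j.+1 + (s - n %/ 2)))%N%:Z)
          ((s + t)%N%:Z - t%:Z - ((n %/ 2).+1 - j.+1 + (s - n %/ 2))%N%:Z) =
    (- qvar) ^+ (s - j) * qbin _ (qvar ^+ 2) (s + t) (s - j)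
      * qbin _ qvar (2 * t + 2 * j) j.
  have le_jh : (j <= n %/ 2)%N by rewrite -ltnS.
  rewrite (_ : (n %/ 2).+1 - j.+1 + (s - n %/ 2) = s - j)%N; last by lia.
  rewrite (_ : (2 * (s + t))%N%:Z - (2 * (s - j))%N%:Z = (2 * t + 2 * j)%N); last by lia.
  rewrite (_ : (s + t)%N%:Z - t%:Z - (s - j)%N%:Z = j); last by lia.
  by rewrite !qbinomE.
under eq_bigr => j _ do rewrite termE.
rewrite big_ord_recl subn0 muln0 qbin0 mulr1 mulrDr mulr1; congr (_ + _).
  (* The shift by 0 is the symmetry [s+t; s] = [s+t; t]. *)
  have := qbin_shift _ _ qvar2_not_root1 s t 0 isT.
  by rewrite subn0 big_ord0 mulr1 => ->.
rewrite mulr_sumr mulr_sumr; apply: eq_bigr => j _; rewrite lift0.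
rewrite qbin_ratio //; [exact: qvar_not_root1 | exact: qvar_neq0 |].
by have := ltn_ord j; lia.
Qed.

Theorem theorem1p5 (a b n : nat) (ha : (0 < a)%N) (hb : (0 < b)%N)
    (hn : (0 < n)%N) (hab : (b < a)%N) :
  eqmod_Phi2 n (T1' a b n)
    ((- qvar) ^+ (a * n - b * n)%N
       * qbinom (qvar ^+ 2) (a * n)%N (b * n)%N
       * (1 - 2 * (a%:R - b%:R) * (1 - vartheta n))).
Proof.
rewrite -[eqmod_Phi2 _ _ _]/(Phi_dvd n 2%N (_ - _)).
rewrite T1'_qfactor // qbinomE -mulrBr -natrB ?(ltnW hab) // -sum_qlucas_vartheta //.
(* M is integral, so only the braces need comparing modulo Phi_n^2. *)
apply: (Phi_dvdM n 0 2).
  apply: (Phi_dvdM n 0 0).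
    rewrite exprNn; apply: (Phi_dvdM n 0 0); first exact: Phi_dvd_sign.
    exact: Phi_dvd_qvarX.
  apply: Phi_dvd_qbin => //; first exact: qvar2_not_root1.
  exact: Phi_dvd_qvarX.
rewrite -mulnBl -(prednK (_ : 0 < a - b)%N) ?subn_gt0 //.
(* With f = 1 - q^(2s), g = 1 - q^n and k = a - b, both f and U + W are divisible by Phi_n, while f
   - 2kg is divisible by Phi_n^2. *)
have split_diff (K : fieldType) (f g U W k : K) :
    1 + f * U - (1 - 2 * k * (g * W)) = f * (U + W) - (f - 2 * k * g) * W.
  by ring.
rewrite split_diff -big_split /=; apply: Phi_dvdB => //.
  apply: (Phi_dvdM n 1 1); first by rewrite mulnA; apply: Phi_dvd_1Xn.
  by apply: (Phi_dvd_sum n hn) => j; apply: ratio_term_eqmod => //;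
    have := ltn_ord j; lia.
apply: (Phi_dvdM n 2 0).
  by rewrite -natrM mulnA; apply: Phi_dvd2_1Xn.
by apply: (Phi_dvd_sum n hn) => j; apply: Phi_dvd_qlucas_term => //;
  have := ltn_ord j; lia.
Qed.
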